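(* Let $f(z)=0$, i.e. $F_1(z)=F_2(z)=0$, be a generic system of two bivariate polynomials supported on a planar simplex circuit $A\subset\mathbb Z^2$. Then, for each $\theta\in\mathbf T^2$, the sector $\operatorname{Arg}^{-1}(\theta)\subset\mathbb C_*^2$ contains at most two solutions of $f(z)=0$.
   Context: A planar simplex circuit is a set $A\subset\mathbb Z^2$ of four points whose convex hull is a (two-dimensional) triangle. The system is supported on $A$ if the supports of $F_1$ and $F_2$ are contained in (not necessarily equal to) $A$, i.e. each $F_j(z)=\sum_{\mathbf a\in A}c_{j,\mathbf a}z^{\mathbf a}$ with $c_{j,\mathbf a}\in\mathbb C$. The system is generic if it has finitely many roots in $\mathbb C_*^2$, where $\mathbb C_*=\mathbb C\setminus\{0\}$. $\operatorname{Arg}:\mathbb C_*^2\to\mathbf T^2=(\mathbb R/2\pi\mathbb Z)^2$ is $\operatorname{Arg}(z)=(\arg z_1,\arg z_2)$. *)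

(* Defs.v *)
From HB Require Import structures.
From mathcomp Require Import all_boot all_order all_algebra finmap.
From mathcomp Require Import ring_quotient generic_quotient complex.
From mathcomp Require Import boolp classical_sets functions cardinality reals.
From mathcomp Require Import convex trigo.

Set Implicit Arguments.
Unset Strict Implicit.
Unset Printing Implicit Defensive.

Import Order.TTheory GRing.Theory Num.Theory.

Local Open Scope classical_set_scope.
Local Open Scope ring_scope.
Local Open Scope complex_scope.
Local Open Scope quotient_scope.

Section ConvexGeometry.
Variable R : realType.

Definition conv_hull (X : set (R^o * R^o)) : set (R^o * R^o) :=
  smallest (@convex_set R (R^o * R^o)%type) X.

(* Linear independence of q - p and r - p says that the triangle is not
   degenerate. *)
Definition is_triangle (T : set (R^o * R^o)) : Prop :=
  exists p q r : R^o * R^o,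
    free [:: q - p; r - p] /\ T = conv_hull [set x | x \in [:: p; q; r]].

Definition lattice_pt (a : int * int) : R^o * R^o := (a.1%:~R, a.2%:~R).

(* The fourth point of A may lie in the interior or on an edge of the triangle. *)
Definition planar_simplex_circuit (A : {fset int * int}) : Prop :=
  #|` A| = 4%N /\ is_triangle (conv_hull [set lattice_pt a | a in [set` A]]).

End ConvexGeometry.

Section Laurent.
Variable C : fieldType.

(* Laurent polynomials in two variables, as finitely supported families of
   coefficients; finsupp F is the support of F. *)
Definition laurent := {fsfun int * int -> C with 0}.

Definition monomial (z : C * C) (a : int * int) : C := z.1 ^ a.1 * z.2 ^ a.2.

Definition leval (F : laurent) (z : C * C) : C :=
  \sum_(a <- finsupp F) F a * monomial z a.

Definition supported_on (A : {fset int * int}) (F : laurent) : Prop :=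
  (finsupp F `<=` A)%fset.

Definition ctorus : set (C * C) := [set z | z.1 != 0 /\ z.2 != 0].

Definition solutions (F1 F2 : laurent) : set (C * C) :=
  [set z | ctorus z /\ leval F1 z = 0 /\ leval F2 z = 0].

Definition generic_system (F1 F2 : laurent) : Prop :=
  finite_set (solutions F1 F2).

End Laurent.

Section Argument.
Variable R : realType.

Definition two_pi_Z : {pred R} :=
  fun x => `[< exists k : int, x = (2 * pi) *~ k >].

Lemma two_pi_Z_zmod_closed : zmod_closed two_pi_Z.
Proof.
split; first by apply/asboolP; exists 0; rewrite mulr0z.
move=> x y /asboolP[k ->] /asboolP[l ->].
by apply/asboolP; exists (k - l); rewrite mulrzBr.
Qed.

HB.instance Definition _ :=
  GRing.isZmodClosed.Build R two_pi_Z two_pi_Z_zmod_closed.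

(* R / 2 pi Z. *)
Definition circle : zmodType := {ideal_quot two_pi_Z}.

(* Principal argument, with values in ]-pi, pi]; the value at 0 is junk. *)
Definition principal_arg (z : R[i]) : R :=
  let t := acos (complex.Re z / complex.Re `|z|) in
  if 0 <= complex.Im z then t else - t.

Lemma principal_arg_polar (z : R[i]) :
  z = `|z| * (cos (principal_arg z) +i* sin (principal_arg z)).
Proof.
have [->|z0] := eqVneq z 0; first by rewrite normr0 mul0r.
case: z z0 => x y z0; rewrite /principal_arg normc_def /=.
set r := Num.sqrt _.
have r2 : r ^+ 2 = x ^+ 2 + y ^+ 2 by rewrite sqr_sqrtr // addr_ge0 ?sqr_ge0.
have r0 : 0 < r.
  rewrite lt_neqAle sqrtr_ge0 andbT eq_sym -sqrf_eq0 r2.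
  rewrite paddr_eq0 ?sqr_ge0 // !sqrf_eq0.
  by apply: contra z0 => /andP[/eqP-> /eqP->].
have rN0 : r != 0 by rewrite gt_eqF.
have q1 : (x / r) ^+ 2 + (y / r) ^+ 2 = 1.
  by rewrite !expr_div_n -mulrDl -r2 divff // expf_neq0.
have xr : -1 <= x / r <= 1.
  rewrite -ler_norml.
  by rewrite -(@ler_pXn2r _ 2) ?nnegrE // expr1n real_normK ?num_real // -q1 lerDl sqr_ge0.
have sE : sin (acos (x / r)) = `|y| / r.
  rewrite sin_acos // -q1 [_ + (y / r) ^+ 2]addrC addrK sqrtr_sqr normrM.
  by rewrite normfV (gtr0_norm r0).
have cE : cos (acos (x / r)) = x / r by rewrite acosK // in_itv.
have pE (u v : R) : r%:C * (u +i* v) = (r * u) +i* (r * v).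
  by apply/eqP; rewrite eq_complex /= !mul0r subr0 addr0 !eqxx.
have [y0|y0] := ifPn.
  by rewrite cE sE ger0_norm // pE !(mulrC r) !divfK.
rewrite cosN sinN cE sE ltr0_norm ?ltNge // mulNr opprK.
by rewrite pE !(mulrC r) !divfK.
Qed.

Definition arg (z : R[i]) : circle := \pi_({ideal_quot two_pi_Z}) (principal_arg z).

Definition Arg (z : R[i] * R[i]) : circle * circle := (arg z.1, arg z.2).

Definition sector (theta : circle * circle) : set (R[i] * R[i]) :=
  [set z | @ctorus R[i] z /\ Arg z = theta].

End Argument.

(* Main.v *)
(* Two solutions in the same sector differ by positive factors, say by the
   exponential of x in R^2, so relative to one solution w the monomial vectors of
   the solutions in the sector are positive points v(x) = (exp <a, x>)_a of a real
   subspace K of R^4. If the coefficient matrix has rank 2, then dim K <= 2, and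
   of three distinct such points one satisfies v(x1) = s v(x0) + t v(x2) with
   s, t > 0. The fourth point b of A has barycentric coordinates alpha, so the b-th
   coordinate of v is the weighted geometric mean of the others; this mean is
   superadditive, and equality forces <a - b, x0 - x1> = 0 whenever alpha_a <> 0.
   As A spans the plane, b must lie on an edge, and only the opposite vertex e can
   escape this. Then K contains the e-th unit vector, so e does not occur in the
   system, which is thus quasi-homogeneous and has infinitely many solutions. If
   the rank is less than 2, the system is a single equation and any solution comes
   with infinitely many others. *)
Require Import Defs.
From mathcomp Require Import all_boot all_order all_algebra finmap complex.
From mathcomp Require Import boolp classical_sets cardinality reals.
From mathcomp Require Import functions interval_inference convex sequences exp.
From mathcomp Require Import trigo ring_quotient ring lra zify.

Set Implicit Arguments.
Unset Strict Implicit.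
Unset Printing Implicit Defensive.

Import Order.TTheory GRing.Theory Num.Theory.

Local Open Scope classical_set_scope.
Local Open Scope card_scope.
Local Open Scope ring_scope.


(** * Convex hulls and oriented triangles in the plane *)

Section Triangles.
Variable R : realType.
Implicit Types (p q r x y : R^o * R^o) (X : set (R^o * R^o)).

Definition dot x y : R := x.1 * y.1 + x.2 * y.2.

Lemma dot_conv (t : {i01 R}) x y (z : R^o * R^o) :
  dot (conv t (x : convex_lmodType (R^o * R^o)%type) y) z =
  t%:num * dot x z + (1 - t%:num) * dot y z.
Proof.
rewrite [conv _ _ _](_ : _ = (t%:num * x.1 + (1 - t%:num) * y.1,
  t%:num * x.2 + (1 - t%:num) * y.2)) // /dot /=; ring.
Qed.

Lemma conv_hull_ge X y k :
  (forall x, X x -> k <= dot x y) -> forall x, conv_hull X x -> k <= dot x y.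
Proof.
move=> Xk; apply: (@smallest_sub _ _ _ [set x | k <= dot x y]) => //.
move=> u v t; rewrite !inE /= dot_conv => ku kv.
have t0 : 0 <= t%:num by [].
have t1 : t%:num <= 1 by [].
nra.
Qed.

Lemma conv_hull_gt X y k :
  (forall x, X x -> k < dot x y) -> forall x, conv_hull X x -> k < dot x y.
Proof.
move=> Xk; apply: (@smallest_sub _ _ _ [set x | k < dot x y]) => //.
move=> u v t; rewrite !inE /= dot_conv => ku kv.
have t0 : 0 <= t%:num by [].
have t1 : t%:num <= 1 by [].
have [->|tn0] := eqVneq t%:num 0; first by rewrite mul0r add0r subr0 mul1r.
have : 0 < t%:num * (dot u y - k) by rewrite mulr_gt0 ?subr_gt0 // lt_neqAle eq_sym tn0.
nra.
Qed.

(** Twice the signed area of the triangle, positive when [p], [q], [r] run counterclockwise. *)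
Definition area2 p q r : R :=
  (q.1 - p.1) * (r.2 - p.2) - (q.2 - p.2) * (r.1 - p.1).

Lemma area2_rot p q r : area2 p q r = area2 q r p.
Proof. rewrite /area2; ring. Qed.

Lemma free_area2 p q r : free [:: q - p; r - p] -> area2 p q r != 0.
Proof.
rewrite free_cons span_seq1 seq1_free => /andP[/vlineP uv v0].
apply/eqP => a0; apply: uv.
case: p q r a0 v0 => [p1 p2] [q1 q2] [r1 r2]; rewrite /area2 /= => a0.
rewrite /GRing.opp /GRing.add /= xpair_eqE negb_and => v0.
have [e|n1] := eqVneq (r1 - p1) 0.
  have n2 : r2 - p2 != 0 by move: v0; rewrite /GRing.zero /= e eqxx.
  exists ((q2 - p2) / (r2 - p2)).
  rewrite /GRing.scale /=; congr pair; rewrite /GRing.scale /=; last first.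
    by rewrite divfK.
  rewrite e mulr0; apply: (mulIf n2); rewrite mul0r.
  by move: a0; rewrite e mulr0 subr0.
exists ((q1 - p1) / (r1 - p1)).
rewrite /GRing.scale /=; congr pair; rewrite /GRing.scale /=; first by rewrite divfK.
apply: (mulIf n1); rewrite mulrAC divfK //.
by apply/eqP; rewrite eq_sym -subr_eq0 a0.
Qed.

(** The vanishing areas put [x] on the lines [rp] and [pq], which meet only at [p]; the two
    identities are Cramer's rule. *)
Lemma area2_eq0 p q r x :
  area2 p q r != 0 -> area2 r p x = 0 -> area2 p q x = 0 -> x = p.
Proof.
move=> D e2 e3.
have x1E : (x.1 - p.1) * area2 p q r =
    (q.1 - p.1) * area2 r p x + (r.1 - p.1) * area2 p q x.
  by rewrite /area2; ring.
have x2E : (x.2 - p.2) * area2 p q r =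
    (q.2 - p.2) * area2 r p x + (r.2 - p.2) * area2 p q x.
  by rewrite /area2; ring.
move: x1E x2E; rewrite e2 e3 !mulr0 addr0 => /eqP + /eqP.
rewrite !mulf_eq0 (negPf D) !orbF !subr_eq0.
by case: x p {D e2 e3} => [u v] [s t] /= /eqP -> /eqP ->.
Qed.

Lemma conv_hull_area2_ge0 X q r : (forall x, X x -> 0 <= area2 q r x) ->
  forall x, conv_hull X x -> 0 <= area2 q r x.
Proof.
move=> X0 x xT.
pose y : R^o * R^o := (- (r.2 - q.2), r.1 - q.1).
have e z : area2 q r z = dot z y - dot q y by rewrite /area2 /dot /=; ring.
rewrite e subr_ge0; apply: conv_hull_ge xT => z /X0.
by rewrite e subr_ge0.
Qed.

Lemma triangle_area2_ge0 p q r x : 0 < area2 p q r ->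
    conv_hull [set x | x \in [:: p; q; r]] x ->
  [/\ 0 <= area2 q r x, 0 <= area2 r p x & 0 <= area2 p q x].
Proof.
move=> D xT.
have D1 : 0 < area2 q r p by rewrite -area2_rot.
have D2 : 0 < area2 r p q by rewrite -area2_rot.
have z1 u v : area2 u v u = 0 by rewrite /area2; ring.
have z2 u v : area2 u v v = 0 by rewrite /area2; ring.
by split; apply: conv_hull_area2_ge0 xT => z /=;
  rewrite !in_cons in_nil orbF => /or3P[] /eqP ->; rewrite ?z1 ?z2 // ltW.
Qed.

(* The open half-plane cut off by the parallel through p to the opposite side
   would otherwise contain the convex hull of X, hence p. *)
Lemma vertex_mem X p q r : 0 < area2 p q r ->
  conv_hull X = conv_hull [set x | x \in [:: p; q; r]] -> X p.
Proof.
move=> D XT; apply: contrapT => Xp.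
pose y : R^o * R^o := (r.2 - q.2, - (r.1 - q.1)).
have e z : area2 q r z = area2 p q r + dot p y - dot z y.
  by rewrite /area2 /dot /=; ring.
suff : dot p y < dot p y by rewrite ltxx.
apply: (@conv_hull_gt X) => [z Xz|]; last first.
  by rewrite XT; apply: sub_gen_smallest; rewrite /= mem_head.
have zT : conv_hull [set x | x \in [:: p; q; r]] z.
  by rewrite -XT; apply: sub_gen_smallest.
have [_ z2 z3] := triangle_area2_ge0 D zT.
(* A point [z] of [X] at least as far from the side [qr] as [p] leaves no area for the other two
   subtriangles, so [z] is [p]. *)
rewrite ltNge; apply/negP => zp.
have sum : area2 q r z + area2 r p z + area2 p q z = area2 p q r.
  by rewrite /area2; ring.
have s0 : area2 r p z + area2 p q z <= 0 by move: sum; rewrite e; lra.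
have e2 : area2 r p z = 0 by lra.
have e3 : area2 p q z = 0 by lra.
by apply: Xp; rewrite -(area2_eq0 (lt0r_neq0 D) e2 e3).
Qed.

End Triangles.

(** * Vertices and barycentric coordinates of a simplex circuit *)

Definition dotz (R : realType) (a : int * int) (y : R * R) : R :=
  a.1%:~R * y.1 + a.2%:~R * y.2.

Lemma lattice_pt_inj (R : realType) : injective (@lattice_pt R).
Proof. by move=> [a b] [c d] [/intr_inj -> /intr_inj ->]. Qed.

(** The vertices of the hull belong to the generating set, and exchanging two of them makes the
    orientation positive. *)
Lemma circuit_oriented (R : realType) (A : {fset int * int}) :
    planar_simplex_circuit R A -> exists p q r : int * int,
  let P := @lattice_pt R p in let Q := lattice_pt R q in let S := lattice_pt R r in
  [/\ 0 < area2 P Q S, p \in A, q \in A, r \in A &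
   conv_hull [set lattice_pt R a | a in [set` A]] =
   conv_hull [set x | x \in [:: P; Q; S]]].
Proof.
move=> [_ [p [q [r [/free_area2]]]]].
wlog D : q r / 0 < area2 p q r => [wl|_ E].
  rewrite neq_lt => /orP[D|D] E; last by apply: (wl q r) => //; rewrite gt_eqF.
  have D' : 0 < area2 p r q.
    by move: D; rewrite /area2 => D; nra.
  apply: (wl r q) => //; first by rewrite gt_eqF.
  rewrite E; congr conv_hull; apply/seteqP; split=> x /=; rewrite !in_cons !in_nil !orbF;
    by case/or3P=> ->; rewrite ?orbT.
have [a Aa aE] := vertex_mem D E.
have [b Ab bE] : [set lattice_pt R a | a in [set` A]] q.
  apply: (@vertex_mem R _ q r p); first by rewrite -area2_rot.
  rewrite E; congr conv_hull; apply/seteqP; split=> x /=; rewrite !in_cons !in_nil !orbF;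
    by case/or3P=> ->; rewrite ?orbT.
have [c Ac cE] : [set lattice_pt R a | a in [set` A]] r.
  apply: (@vertex_mem R _ r p q); first by rewrite area2_rot.
  rewrite E; congr conv_hull; apply/seteqP; split=> x /=; rewrite !in_cons !in_nil !orbF;
    by case/or3P=> ->; rewrite ?orbT.
by exists a, b, c; rewrite aE bE cE.
Qed.

(* The point b is the one that is not a vertex, and alpha are its barycentric
   coordinates. *)
Lemma circuit_weights (R : realType) (A : {fset int * int}) :
    planar_simplex_circuit R A -> exists b (alpha : int * int -> R),
  [/\ b \in A, forall a, 0 <= alpha a, \sum_(a <- A) alpha a = 1,
    (forall y, dotz b y = \sum_(a <- A) alpha a * dotz a y) &
    {in A &, forall a c, a != b -> c != b -> alpha a = 0 -> alpha c = 0 -> a = c}].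
Proof.
move=> circA; have [p [q [r /= [D Ap Aq Ar E]]]] := circuit_oriented circA.
have [A4 _] := circA.
have D0 := lt0r_neq0 D.
have ne x y z :
    area2 (lattice_pt R x) (lattice_pt R y) (lattice_pt R z) != 0 -> x != y.
  by apply: contraNneq => ->; rewrite /area2 /=; apply/eqP; ring.
have pq : p != q by apply: ne D0.
have qr : q != r by apply: (ne _ _ p); rewrite -area2_rot.
have rp : r != p by apply: (ne _ _ q); rewrite area2_rot.
have Aq' : q \in (A `\ p)%fset by rewrite !inE eq_sym pq.
have Ar' : r \in (A `\ p `\ q)%fset by rewrite !inE rp eq_sym qr.
have /cardfs1P[b bE] : #|` (A `\ p `\ q `\ r)%fset| == 1%N.
  by move: A4; rewrite (cardfsD1 p) Ap (cardfsD1 q) Aq' (cardfsD1 r) Ar'; lia.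
have : b \in (A `\ p `\ q `\ r)%fset by rewrite bE inE.
rewrite !inE => /and4P[br bq bp Ab].
pose B := lattice_pt R b.
have [hp hq hr] : [/\ 0 <= area2 (lattice_pt R q) (lattice_pt R r) B,
    0 <= area2 (lattice_pt R r) (lattice_pt R p) B &
    0 <= area2 (lattice_pt R p) (lattice_pt R q) B].
  apply: triangle_area2_ge0 => //; rewrite -E.
  by apply: sub_gen_smallest; exists b.
(* Barycentric coordinates as area ratios: the weight of a vertex is the area of the subtriangle
   spanned by [B] and the opposite side, over the total area. *)
pose alpha a := (if a == p then area2 (lattice_pt R q) (lattice_pt R r) B
  else if a == q then area2 (lattice_pt R r) (lattice_pt R p) B
  else if a == r then area2 (lattice_pt R p) (lattice_pt R q) B else 0)
  / area2 (lattice_pt R p) (lattice_pt R q) (lattice_pt R r).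
have alphap : alpha p = area2 (lattice_pt R q) (lattice_pt R r) B /
   area2 (lattice_pt R p) (lattice_pt R q) (lattice_pt R r) by rewrite /alpha eqxx.
have alphaq : alpha q = area2 (lattice_pt R r) (lattice_pt R p) B /
   area2 (lattice_pt R p) (lattice_pt R q) (lattice_pt R r).
  by rewrite /alpha eq_sym (negPf pq) eqxx.
have alphar : alpha r = area2 (lattice_pt R p) (lattice_pt R q) B /
   area2 (lattice_pt R p) (lattice_pt R q) (lattice_pt R r).
  by rewrite /alpha (negPf rp) eq_sym (negPf qr) eqxx.
have alphab : alpha b = 0.
  by rewrite /alpha (negPf bp) (negPf bq) (negPf br) mul0r.
have sumE (f : int * int -> R) :
    \sum_(a <- A) alpha a * f a = alpha p * f p + (alpha q * f q + alpha r * f r).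
  rewrite (big_fsetD1 p) //= (big_fsetD1 q) //= (big_fsetD1 r) //= bE.
  by rewrite big_seq_fset1 alphab mul0r addr0.
have AE a : a \in A -> a != b -> [|| a == p, a == q | a == r].
  move=> Aa; apply: contra_neqT; rewrite !negb_or => /and3P[ap aq ar].
  have : a \in (A `\ p `\ q `\ r)%fset by rewrite !inE ap aq ar Aa.
  by rewrite bE inE => /eqP.
exists b, alpha; split=> //.
- by move=> a; apply: divr_ge0; [do 3![case: ifP => // _] | exact: ltW].
- under eq_bigr do rewrite -[alpha _]mulr1.
  rewrite sumE !mulr1 alphap alphaq alphar -!mulrDl.
  by apply: (mulIf D0); rewrite divfK // mul1r /area2; ring.
- move=> y; rewrite sumE alphap alphaq alphar /dotz.
  rewrite -!(mulrAC _ (_ + _)) -!mulrDl; apply: (mulIf D0).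
  by rewrite divfK // /area2 /=; ring.
have a0 a z : alpha a = z / area2 (lattice_pt R p) (lattice_pt R q) (lattice_pt R r) ->
    alpha a = 0 -> z = 0.
  by move=> -> /eqP; rewrite mulf_eq0 invr_eq0 (negPf D0) orbF => /eqP.
have bN c : b != c -> B <> lattice_pt R c by move=> /eqP bc /lattice_pt_inj.
(* Two vanishing weights put [B] on two side lines, hence at their common vertex, although [b] is
   not a vertex. *)
have npq : ~ (alpha p = 0 /\ alpha q = 0).
  move=> [/(a0 _ _ alphap) u /(a0 _ _ alphaq) v].
  by apply: (bN r br); apply: area2_eq0 u v; rewrite area2_rot.
have nqr : ~ (alpha q = 0 /\ alpha r = 0).
  move=> [/(a0 _ _ alphaq) u /(a0 _ _ alphar) v].
  by apply: (bN p bp); apply: area2_eq0 u v.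
have nrp : ~ (alpha r = 0 /\ alpha p = 0).
  move=> [/(a0 _ _ alphar) u /(a0 _ _ alphap) v].
  by apply: (bN q bq); apply: area2_eq0 u v; rewrite -area2_rot.
move=> a c Aa Ac ab cb.
by case/or3P: (AE a Aa ab) => /eqP ->; case/or3P: (AE c Ac cb) => /eqP -> u v //;
   exfalso; tauto.
Qed.

(** Subtracting the equations at the three vertices makes [y] orthogonal to two independent edge
    vectors. *)
Lemma circuit_span (R : realType) (A : {fset int * int}) (y : R * R) (k : R) :
  planar_simplex_circuit R A -> (forall a, a \in A -> dotz a y = k) -> y = 0.
Proof.
move=> /circuit_oriented[p [q [r /= [D Ap Aq Ar _]]]] yk.
have := lt0r_neq0 D.
move: (yk p Ap) (yk q Aq) (yk r Ar); rewrite /dotz /area2 /= => ep eq er D0.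
case: y {yk} ep eq er => [u v] /= ep eq er.
have eqp : (q.1%:~R - p.1%:~R) * u + (q.2%:~R - p.2%:~R) * v = 0 by lra.
have erp : (r.1%:~R - p.1%:~R) * u + (r.2%:~R - p.2%:~R) * v = 0 by lra.
congr pair; apply: (mulIf D0); rewrite mul0r.
  transitivity ((r.2%:~R - p.2%:~R) * ((q.1%:~R - p.1%:~R) * u + (q.2%:~R - p.2%:~R) * v)
    - (q.2%:~R - p.2%:~R) * ((r.1%:~R - p.1%:~R) * u + (r.2%:~R - p.2%:~R) * v)); first by ring.
  by rewrite eqp erp !mulr0 subr0.
transitivity ((q.1%:~R - p.1%:~R) * ((r.1%:~R - p.1%:~R) * u + (r.2%:~R - p.2%:~R) * v)
  - (r.1%:~R - p.1%:~R) * ((q.1%:~R - p.1%:~R) * u + (q.2%:~R - p.2%:~R) * v)); first by ring.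
by rewrite eqp erp !mulr0 subr0.
Qed.


(** * Infinite sets and sets of more than two elements *)

Lemma infinite_inj_seq (T : Type) (S : set T) (f : nat -> T) :
  injective f -> (forall n, S (f n)) -> infinite_set S.
Proof.
move=> finj Sf Sfin; apply: infinite_nat.
rewrite (_ : setT = f @^-1` S); last by apply/seteqP; split=> n //= _.
by apply: finite_preimage => // x y _ _; apply: finj.
Qed.

Lemma three_of_card_gt2 (T : choiceType) (S : set T) :
  finite_set S -> ~ (S #<= `I_2) ->
  exists x y z, [/\ S x, S y & S z] /\ [/\ x <> y, y <> z & x <> z].
Proof.
move=> Sfin S2; have [X SX] := finite_fsetP.1 Sfin; subst S.
have X3 : (2 < #|` X|)%N.
  rewrite ltnNge; apply/negP => le; apply: S2.
  by rewrite (card_le_eql (introT card_eq_fsetP erefl)) card_le_II.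
have /fset0Pn[x xX] : X != fset0 by rewrite -cardfs_gt0; lia.
have X2 : (1 < #|` (X `\ x)%fset|)%N by rewrite (cardfsD1 x) xX in X3; lia.
have /fset0Pn[y yX] : (X `\ x)%fset != fset0 by rewrite -cardfs_gt0; lia.
have X1 : (0 < #|` (X `\ x `\ y)%fset|)%N by rewrite (cardfsD1 y) yX in X2; lia.
have /fset0Pn[z zX] : (X `\ x `\ y)%fset != fset0 by rewrite -cardfs_gt0; lia.
move: yX zX; rewrite !inE => /andP[/eqP yx yX] /and3P[/eqP zy /eqP zx zX].
by exists x, y, z; split; split=> // /esym.
Qed.

(** After splitting off the root 0, either the cofactor has a root, necessarily nonzero, or [p] is a
    monomial, which two nonzero coefficients exclude. *)
Lemma two_coef_root (C : closedFieldType) (p : {poly C}) i j :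
  p`_i != 0 -> p`_j != 0 -> i != j -> exists2 t, t != 0 & root p t.
Proof.
move=> pi pj ij.
have p0 : p != 0 by apply: contraNneq pi => ->; rewrite coef0.
have [m [q]] := multiplicity_XsubC p 0; rewrite p0 subr0 /= => q0 pE.
have [/closed_rootP[t qt]|/negPn/size_poly1P[c c0 qE]] := boolP (size q != 1).
  exists t; first by apply: contraNneq q0 => <-.
  by rewrite pE rootM qt.
move: pi pj; rewrite pE qE !coefCM !coefXn.
have [im|_] := eqVneq i m; last by rewrite mulr0 eqxx.
have [jm|_] := eqVneq j m; last by rewrite mulr0 eqxx.
by rewrite im jm eqxx in ij.
Qed.

(** * Zeros of a single Laurent polynomial on the torus *)

Section Laurent.
Variable C : closedFieldType.
Implicit Types (F : laurent C) (z : C * C).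

Lemma monomial_neq0 z a : ctorus z -> monomial z a != 0.
Proof. by move=> [z1 z2]; rewrite mulf_neq0 ?expfz_neq0. Qed.

Lemma leval_supp (A : {fset int * int}) F z : supported_on A F ->
  leval F z = \sum_(a <- A) F a * monomial z a.
Proof.
move=> FA; rewrite /leval (big_fset_incl _ FA) // => a _ aF.
by rewrite fsfun_dflt ?mul0r.
Qed.

(* On the curve t |-> (t, q t^N) with N large the monomials of F restrict to
   distinct powers of t. *)
Lemma leval_root_on_curve F z0 : ctorus z0 -> leval F z0 = 0 ->
  exists N : int, forall q, q != 0 ->
    exists2 t, t != 0 & leval F (t, q * t ^ N) = 0.
Proof.
move=> z0T Fz0.
have [S0|[a aS]] := fset_0Vmem (finsupp F).
  exists 0 => q _; exists 1; first exact: oner_neq0.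
  by rewrite /leval S0 big_seq_fset0.
have [S0|[b]] := fset_0Vmem (finsupp F `\ a)%fset.
  move: Fz0; rewrite /leval (big_fsetD1 a) //= S0 big_seq_fset0 addr0.
  move/eqP; rewrite mulf_eq0 (negPf (monomial_neq0 _ z0T)) orbF.
  by rewrite mem_finsupp in aS; rewrite (negPf aS).
rewrite !inE => /andP[ba bS].
have bound (f : int * int -> int) : exists m : nat,
    forall c, c \in finsupp F -> (`|f c| <= m)%N.
  exists (\sum_(c <- finsupp F) `|f c|)%N => c cS.
  by rewrite (big_fsetD1 c) //= leq_addr.
have [B BE] := bound fst.
(* First exponents differ by at most [2 * B], so with this [N] the number [c.1 + N * c.2] determines
   [c]. The shift by [M] then makes all exponents of [t] nonnegative. *)
pose N : int := (2 * B + 1)%N.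
have [M ME] := bound (fun c => c.1 + N * c.2).
pose e (c : int * int) := `|(c.1 + N * c.2 + M%:Z)%R|%N.
have eE c : c \in finsupp F -> (e c)%:Z = c.1 + N * c.2 + M.
  by move=> /ME; rewrite /e; move: (c.1 + N * c.2) => k; lia.
have einj : {in finsupp F &, injective e}.
  move=> [c1 c2] [d1 d2] cS dS ecd.
  have := eE _ cS; rewrite ecd (eE _ dS) /= => /addIr E.
  have := BE _ cS; have := BE _ dS; rewrite /= => dB cB.
  have c2d2 : c2 = d2.
    have : (2 * B + 1)%:Z * (c2 - d2) = d1 - c1 by move: E; rewrite /N; lia.
    by nia.
  by move: E; rewrite c2d2 => /addIr ->.
exists N => q q0.
pose p := \sum_(c <- finsupp F) (F c * q ^ c.2) *: 'X^(e c).
have pe c : c \in finsupp F -> p`_(e c) != 0.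
  move=> cS; rewrite /p coef_sum (big_fsetD1 c) //= coefZ coefXn eqxx mulr1.
  rewrite big_seq big1 ?addr0 => [|d].
    by rewrite mulf_neq0 ?expfz_neq0 // -mem_finsupp.
  rewrite !inE => /andP[dc dS]; rewrite coefZ coefXn.
  by case: eqP => [/einj E|]; rewrite ?mulr0 //; rewrite E ?eqxx in dc.
have [|t t0 /rootP pt] := two_coef_root (pe a aS) (pe b bS).
  by apply: contra ba => /eqP /einj -> //.
exists t => //; apply: (mulIf (expfz_neq0 M t0)).
rewrite mul0r -pt /p horner_sum /leval mulr_suml; apply: eq_big_seq => c cS.
rewrite hornerZ hornerXn /monomial /= expfzMl exprz_exp -!mulrA; congr (_ * _).
by rewrite mulrCA; congr (_ * _); rewrite -!expfzDr // exprnP eE // addrA.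
Qed.

End Laurent.

(** One zero is taken on each of the curves with [q] equal to 1, 2, 3 and so on; for a common [N]
    these are disjoint in the torus. *)
Lemma infinite_zeros (C : numClosedFieldType) (F : laurent C) z :
    ctorus z -> leval F z = 0 ->
  infinite_set [set z | ctorus z /\ leval F z = 0].
Proof.
move=> zT Fz; have [N NP] := leval_root_on_curve zT Fz.
have n0 n : n.+1%:R != 0 :> C by rewrite pnatr_eq0.
have /choice[t tP] (n : nat) :
    exists t, t != 0 /\ leval F (t, n.+1%:R * t ^ N) = 0.
  by have [t] := NP _ (n0 n); exists t.
apply: (@infinite_inj_seq _ _ (fun n => (t n, n.+1%:R * t n ^ N))) => [m n [-> ]|n] /=.
  move/(mulIf (expfz_neq0 N (tP n).1)) => /eqP.
  by rewrite eqr_nat => /eqP[].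
by split; [split=> /=; [exact: (tP n).1 | rewrite mulf_neq0 ?expfz_neq0 // (tP n).1] |
  exact: (tP n).2].
Qed.

(* When all 2 x 2 minors of the coefficient matrix vanish, the system is a single
   equation. *)
Lemma infinite_solutions_dependent (C : numClosedFieldType) (F1 F2 : laurent C) z :
    (forall a b, F1 a * F2 b = F1 b * F2 a) -> solutions F1 F2 z ->
  infinite_set (solutions F1 F2).
Proof.
move=> minors [zT [F1z F2z]].
have [F1_0|/existsNP[b /eqP b0]] := pselect (forall a, F1 a = 0).
  apply: sub_infinite_set (infinite_zeros zT F2z) => x [xT F2x]; split=> //; split=> //.
  by rewrite /leval big1 // => a _; rewrite F1_0 mul0r.
apply: sub_infinite_set (infinite_zeros zT F1z) => x [xT F1x]; split=> //; split=> //.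
pose A := (finsupp F1 `|` finsupp F2)%fset.
have A1 : supported_on A F1 by apply: fsubsetUl.
have A2 : supported_on A F2 by apply: fsubsetUr.
(* The vanishing minors give [F1 b * F2 = F2 b * F1], and [F1 b] is nonzero. *)
apply: (mulfI b0); rewrite mulr0 (leval_supp _ A2) mulr_sumr.
transitivity (F2 b * leval F1 x); last by rewrite F1x mulr0.
rewrite (leval_supp _ A1) mulr_sumr; apply: eq_bigr => a _.
by rewrite !mulrA -minors (mulrC (F1 a)).
Qed.


(** * Weighted means of exponentials and positive combinations *)

Section Weights.
Variable (R : realType) (T : eqType).

(* Termwise, expR (u i - U) >= 1 + (u i - U); the two families sum to the same
   value, so that all these inequalities are equalities. *)
Lemma expR_mean_eq (s : seq T) (al u w : T -> R) (U W : R) :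
    (forall i, 0 <= al i) -> \sum_(i <- s) al i = 1 ->
    U = \sum_(i <- s) al i * u i -> W = \sum_(i <- s) al i * w i ->
    expR U + expR W = 1 ->
    (forall i, i \in s -> expR (u i) + expR (w i) = 1) ->
  forall i, i \in s -> al i != 0 -> u i = U.
Proof.
move=> al0 al1 UE WE UW uw.
have defect (v : T -> R) V i : 0 <= al i * (expR (v i - V) - 1 - (v i - V)).
  by rewrite mulr_ge0 // -addrA -opprD subr_ge0 expR_ge1Dx.
(* The weights sum to 1 and [V] is the mean of [v], so the linear terms cancel. *)
have sum_defect (v : T -> R) V : V = \sum_(i <- s) al i * v i ->
  \sum_(i <- s) al i * (expR (v i - V) - 1 - (v i - V)) =
  (\sum_(i <- s) al i * expR (v i)) / expR V - 1.
  move=> VE; transitivity (\sum_(i <- s)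
      (al i * expR (v i) / expR V - al i - (al i * v i - al i * V))).
    by apply: eq_bigr => i _; rewrite expRB; ring.
  rewrite !big_split /= sumrN al1 sumrN big_split /= sumrN -VE -!mulr_suml al1; ring.
have dU : 0 <= (\sum_(i <- s) al i * expR (u i)) / expR U - 1.
  by rewrite -sum_defect //; apply: sumr_ge0.
have dW : 0 <= (\sum_(i <- s) al i * expR (w i)) / expR W - 1.
  by rewrite -sum_defect //; apply: sumr_ge0.
have total : \sum_(i <- s) al i * expR (u i) + \sum_(i <- s) al i * expR (w i) = 1.
  rewrite -big_split /= -al1; apply: eq_big_seq => i si.
  by rewrite -mulrDr uw ?mulr1.
have U0 := expR_gt0 U; have W0 := expR_gt0 W.
(* The weighted sums of exponentials are at least [expR U] and [expR W], while both pairs add up to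
   1; hence both bounds are attained. *)
have eqU : \sum_(i <- s) al i * (expR (u i - U) - 1 - (u i - U)) == 0.
  rewrite sum_defect // subr_eq0; apply/eqP.
  move: dU dW; rewrite !subr_ge0 !ler_pdivlMr // !mul1r => dU dW.
  by apply: (mulIf (lt0r_neq0 U0)); rewrite divfK ?gt_eqF // mul1r; lra.
rewrite psumr_eq0 // in eqU; move=> i si ai.
move/allP: eqU => /(_ i si) /=; rewrite mulf_eq0 (negPf ai) /=.
apply: contraTeq => uU.
by rewrite gt_eqF // -addrA -opprD subr_gt0 expR_gt1Dx // subr_eq0.
Qed.

End Weights.

(** The vectors are sorted by the ratio of their coordinates, so the middle one lies in the cone of
    the outer two; Cramer's rule gives [s] and [t]. *)
Lemma nonneg_combination (R : realFieldType) (X0 Y0 X1 Y1 X2 Y2 : R) :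
    0 < X0 -> 0 < Y0 -> 0 < X1 -> 0 < Y1 -> 0 < X2 -> 0 < Y2 ->
    X0 * Y1 <= X1 * Y0 -> X1 * Y2 <= X2 * Y1 ->
  exists s t, [/\ 0 <= s, 0 <= t, X1 = s * X0 + t * X2 & Y1 = s * Y0 + t * Y2].
Proof.
move=> X0_gt0 Y0_gt0 X1_gt0 Y1_gt0 X2_gt0 Y2_gt0 le01 le12.
have [D0|D0] := ltP 0 (X2 * Y0 - X0 * Y2).
  exists ((X2 * Y1 - X1 * Y2) / (X2 * Y0 - X0 * Y2)).
  exists ((X1 * Y0 - X0 * Y1) / (X2 * Y0 - X0 * Y2)).
  have Dn := lt0r_neq0 D0.
  split; [| |by field|by field].
    by apply: divr_ge0; [rewrite subr_ge0 | exact: ltW].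
  by apply: divr_ge0; [rewrite subr_ge0 | exact: ltW].
(* If the cone degenerates, the middle vector is parallel to the first. *)
exists (X1 / X0), 0; split=> //; first by rewrite divr_ge0 ?ltW.
  by field; rewrite gt_eqF.
have e : X0 * Y1 = X1 * Y0.
  apply/eqP; rewrite eq_le le01 /=.
  have : X1 * Y0 * (X2 * Y1) <= X0 * Y1 * (X2 * Y1).
    have : (X1 * Y2) * (X0 * Y1) <= X2 * Y1 * (X0 * Y1) by rewrite ler_pM2r // mulr_gt0.
    have : (X2 * Y0) * (X1 * Y1) <= X0 * Y2 * (X1 * Y1).
      by rewrite ler_pM2r ?mulr_gt0 // -subr_le0.
    lra.
  by rewrite ler_pM2r // mulr_gt0.
apply: (mulIf (lt0r_neq0 X0_gt0)); rewrite mul0r addr0 mulrC e.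
by field; rewrite gt_eqF.
Qed.

Local Open Scope complex_scope.

(** * Sectors as orbits of positive dilations *)

Section Sector.
Variable R : realType.
Implicit Types (z : R[i]) (w : R[i] * R[i]) (x y : R * R).

Lemma periodicz (f : R -> R) (t : R) (k : int) u :
  periodic f t -> f (u + t *~ k) = f u.
Proof.
move=> ft; case: k => n; first exact: periodicn.
by rewrite NegzE mulrNz -(periodicn ft n.+1) -pmulrn addrNK.
Qed.

(** The polar angles agree up to a multiple of [2 * pi], so the quotient is the ratio of the moduli,
    a positive real and thus an exponential. *)
Lemma arg_eq_scale z z' : z != 0 -> z' != 0 -> arg z = arg z' ->
  exists x : R, z' = z * (expR x)%:C.
Proof.
move=> z0 z'0 /esym/eqP; rewrite /arg -Quotient.idealrBE => /asboolP[k kE].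
have [r r0 rE] : exists2 r : R, 0 < r & `|z'| / `|z| = r%:C.
  have : 0 < `|z'| / `|z| by rewrite divr_gt0 ?normr_gt0.
  case: (_ / _) => re im; rewrite ltcE /= => /andP[/eqP -> re0].
  by exists re.
have [x xE] := expR_total r0; exists x; rewrite xE -rE.
have angle : principal_arg z' = principal_arg z + (2 * pi) *~ k.
  by rewrite -kE addrC subrK.
rewrite {1}[z in RHS]principal_arg_polar {1}[z']principal_arg_polar angle.
rewrite mulr_natl !periodicz; [|exact: sinD2pi|exact: cosD2pi].
by rewrite mulrAC (mulrC `|z| (_ / _)) divfK ?normr_eq0.
Qed.

(** The action of the positive reals on each coordinate, in logarithmic form; on the torus its
    orbits are the sectors. *)
Definition dilate w x : R[i] * R[i] := (w.1 * (expR x.1)%:C, w.2 * (expR x.2)%:C).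

Lemma dilate_inj w : @ctorus R[i] w -> injective (dilate w).
Proof.
move=> [w1 w2] [x1 x2] [y1 y2] [/(mulfI w1) e1 /(mulfI w2) e2].
by move: e1 e2 => /(@complexI R) /expR_inj -> /(@complexI R) /expR_inj ->.
Qed.

Lemma dilate_ctorus w x : @ctorus R[i] w -> @ctorus R[i] (dilate w x).
Proof.
by move=> [w1 w2]; split; rewrite /= mulf_neq0 // fmorph_eq0 expR_eq0.
Qed.

Lemma expR_intmul (u : R) (k : int) : expR u ^ k = expR (k%:~R * u).
Proof.
case: k => n; first by rewrite -exprnP -expRM_natl.
by rewrite NegzE -exprnN -expRM_natl -expRN mulrNz mulNr.
Qed.

Lemma monomial_dilate w x a :
  monomial (dilate w x) a = monomial w a * (expR (dotz a x))%:C.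
Proof.
rewrite /monomial /dilate /= !expfzMl /dotz expRD rmorphM -!expR_intmul.
by rewrite !rmorphXz ?unitfE ?expR_eq0 // mulrACA.
Qed.

Lemma leval_dilate A F w x : supported_on A F -> leval F (dilate w x) =
  \sum_(a <- A) F a * monomial w a * (expR (dotz a x))%:C.
Proof.
move=> FA; rewrite (leval_supp _ FA); apply: eq_bigr => a _.
by rewrite monomial_dilate mulrA.
Qed.

Lemma sector_dilate theta w w' : sector theta w -> sector theta w' ->
  exists x, w' = dilate w x.
Proof.
case: w w' => [u v] [u' v'] [[/= u0 v0] <-] [[/= u'0 v'0]] [eu ev].
have [x1 ->] := arg_eq_scale u0 u'0 (esym eu).
have [x2 ->] := arg_eq_scale v0 v'0 (esym ev).
by exists (x1, x2).
Qed.

(* Without the coefficients at e the system is quasi-homogeneous, and its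
   solutions come in the orbits w exp(n y). *)
Lemma infinite_solutions_edge A (F1 F2 : laurent R[i]) w y k e :
    supported_on A F1 -> supported_on A F2 -> solutions F1 F2 w -> y != 0 ->
    F1 e = 0 -> F2 e = 0 -> {in A, forall a, a != e -> dotz a y = k} ->
  infinite_set (solutions F1 F2).
Proof.
move=> A1 A2 [wT [F1w F2w]] y0 F1e F2e yk.
have homog F (n : nat) : supported_on A F -> F e = 0 ->
    leval F (dilate w (n%:R * y.1, n%:R * y.2)) = leval F w * (expR (n%:R * k))%:C.
  move=> AF Fe; rewrite (leval_dilate _ _ AF) (leval_supp _ AF) mulr_suml.
  apply: eq_big_seq => a aA; have [->|ae] := eqVneq a e; first by rewrite Fe !mul0r.
  by rewrite -(yk a aA ae) /dotz /=; congr (_ * (expR _)%:C); ring.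
apply: (@infinite_inj_seq _ _ (fun n : nat => dilate w (n%:R * y.1, n%:R * y.2)))
  => [m n|n].
  case/(dilate_inj wT) => e1 e2; apply/eqP; move: y0; case: y e1 e2 {yk homog} => [u v] /=.
  move=> e1 e2; rewrite /GRing.zero /= xpair_eqE negb_and => /orP[] h0.
    by move/(mulIf h0): e1 => /eqP; rewrite eqr_nat.
  by move/(mulIf h0): e2 => /eqP; rewrite eqr_nat.
split; first exact: dilate_ctorus.
by rewrite !homog // F1w F2w !mul0r.
Qed.

(** * Three solutions in one sector *)

Lemma dotzB a x y : dotz a (x.1 - y.1, x.2 - y.2) = dotz a x - dotz a y.
Proof. by rewrite /dotz /=; ring. Qed.

(** In exponential form: proportional vectors [expR (dotz a x)] and [expR (dotz a y)] over [A] come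
    from the same point, [k] being the logarithm of the factor. *)
Lemma circuit_eq A x y (k : R) : planar_simplex_circuit R A ->
  {in A, forall a, dotz a x = dotz a y + k} -> x = y.
Proof.
move=> circA xy; have : (x.1 - y.1, x.2 - y.2) = 0 :> R * R.
  by apply: (circuit_span (k := k) circA) => a aA; rewrite dotzB xy // addrAC subrr add0r.
by case: x y {xy} => [x1 x2] [y1 y2] [] /= /eqP + /eqP; rewrite !subr_eq0 => /eqP -> /eqP ->.
Qed.

Lemma infinite_solutions_middle A (F1 F2 : laurent R[i]) w x0 x1 x2 (s t : R) :
    planar_simplex_circuit R A -> supported_on A F1 -> supported_on A F2 ->
    solutions F1 F2 (dilate w x0) -> solutions F1 F2 (dilate w x1) ->
    @ctorus R[i] w -> x0 <> x1 -> x1 <> x2 -> 0 <= s -> 0 <= t ->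
    {in A, forall a, expR (dotz a x1) = s * expR (dotz a x0) + t * expR (dotz a x2)} ->
  infinite_set (solutions F1 F2).
Proof.
move=> circA A1 A2 sol0 sol1 wT x01 x12 s0 t0 mid.
have prop (u v : R * R) (r : R) : 0 <= r ->
    {in A, forall a, expR (dotz a u) = r * expR (dotz a v)} -> u = v.
  move=> r0 uv; have [b [_ [bA _ _ _ _]]] := circuit_weights circA.
  have rP : 0 < r.
    rewrite lt_neqAle r0 andbT eq_sym; apply/eqP => rE.
    by have := expR_gt0 (dotz b u); rewrite uv // rE mul0r ltxx.
  have [l lE] := expR_total rP.
  have : {in A, forall a, dotz a u = dotz a v + l}.
    by move=> a aA; apply: (@expR_inj R); rewrite uv // expRD lE mulrC.
  exact: circuit_eq circA.
(* If [s] or [t] were zero, the vector of [x1] would be proportional to that of [x2] or [x0],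
   forcing equal points. *)
have sP : 0 < s.
  rewrite lt_neqAle s0 andbT eq_sym; apply/eqP => sE; apply: x12.
  by apply: (prop _ _ t) => // a aA; rewrite mid // sE mul0r add0r.
have tP : 0 < t.
  rewrite lt_neqAle t0 andbT eq_sym; apply/eqP => tE; apply: x01; apply: esym.
  by apply: (prop _ _ s) => // a aA; rewrite mid // tE mul0r addr0.
have [ls sE] := expR_total sP; have [lt tE] := expR_total tP.
have [b [al [bA al0 al1 bE alN]]] := circuit_weights circA.
pose y : R * R := (x0.1 - x1.1, x0.2 - x1.2).
pose y2 : R * R := (x2.1 - x1.1, x2.2 - x1.2).
have y_neq0 : y != 0.
  apply: contra_notN x01 => /eqP[/eqP + /eqP].
  rewrite !subr_eq0 => /eqP e1 /eqP e2.
  by case: x0 x1 e1 e2 {y y2 mid sol0 sol1 x12} => ? ? [? ?] /= -> ->.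
(* The relation [mid] divided by [expR (dotz a x1)]. It also holds at [b], whose exponents are the
   weighted means of all the others: the equality case of the mean inequality. *)
have one a : a \in A -> expR (dotz a y + ls) + expR (dotz a y2 + lt) = 1.
  move=> aA; rewrite !dotzB (expRD _ ls) (expRD _ lt) !expRB sE tE.
  apply: (mulIf (lt0r_neq0 (expR_gt0 (dotz a x1)))); rewrite mul1r [RHS]mid //.
  by field; rewrite gt_eqF // expR_gt0.
have mean (z : R * R) (l : R) : dotz b z + l = \sum_(a <- A) al a * (dotz a z + l).
  under eq_bigr do rewrite mulrDr.
  by rewrite big_split /= -mulr_suml al1 mul1r -bE.
have yb a : a \in A -> al a != 0 -> dotz a y = dotz b y.
  move=> aA aN; apply: (@addIr _ ls).
  exact: (expR_mean_eq al0 al1 (mean y ls) (mean y2 lt) (one b bA) one aA aN).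
(* An exceptional [e] has weight zero, and at most one point other than [b] has; so [y] pairs to the
   same value with all other points of [A]. *)
have [[e [eA eb ee]]|none] :=
    pselect (exists e, [/\ e \in A, e != b & dotz e y != dotz b y]).
  have yk a : a \in A -> a != e -> dotz a y = dotz b y.
    move=> aA ae; have [->//|ab] := eqVneq a b.
    apply: (yb) => //; apply: contraNneq ae => a0; apply/eqP; apply: alN => //.
    by apply/eqP; apply: contraNT ee => e0; rewrite yb.
  (* Subtracting [expR (dotz b y)] times the equation at [x1] from that at [x0] cancels every term
     except the one at [e], whose factor is nonzero. *)
  have coef0 F : supported_on A F -> leval F (dilate w x0) = 0 ->
      leval F (dilate w x1) = 0 -> F e = 0.
    move=> AF; rewrite !(leval_dilate _ _ AF) => F0 F1x.
    have : \sum_(a <- A) F a * monomial w a * (expR (dotz a x0) -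
        expR (dotz b y) * expR (dotz a x1))%:C = 0.
      transitivity (\sum_(a <- A) F a * monomial w a * (expR (dotz a x0))%:C -
         (expR (dotz b y))%:C * \sum_(a <- A) F a * monomial w a * (expR (dotz a x1))%:C).
        rewrite mulr_sumr -sumrB; apply: eq_bigr => a _.
        by rewrite rmorphB rmorphM /=; ring.
      by rewrite F0 F1x mulr0 subr0.
    rewrite (big_fsetD1 e) //= big_seq big1 ?addr0 => [/eqP|a].
      rewrite mulf_eq0 (mulf_eq0 (F e)) (negPf (monomial_neq0 _ wT)) orbF fmorph_eq0.
      case/orP => [/eqP //|]; rewrite subr_eq0 -expRD => /eqP /expR_inj ey.
      by move: ee; rewrite dotzB ey addrK eqxx.
    rewrite !inE => /andP[ae aA]; rewrite -(yk a aA ae) -expRD dotzB subrK subrr.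
    by rewrite mulr0.
  apply: (infinite_solutions_edge A1 A2 sol0 y_neq0 _ _ (k := dotz b y) (e := e)) => //.
    by apply: coef0 => //; [case: sol0 => _ [] | case: sol1 => _ []].
  by apply: coef0 => //; [case: sol0 => _ [] | case: sol1 => _ []].
(* Without an exception [y] pairs to a constant with all of [A], so it vanishes, against
   [x0 <> x1]. *)
case/eqP: y_neq0; apply: (circuit_span (k := dotz b y) circA) => a aA.
have [->//|ab] := eqVneq a b.
by apply: contra_notP none => /eqP ay; exists a.
Qed.

(* By Cramer's rule the coordinates a and b of the monomial vectors depend linearly
   on the coordinates c and d, and the solutions are ordered by the slope of the
   latter. *)
Lemma infinite_solutions_sorted A (F1 F2 : laurent R[i]) w x0 x1 x2 a b c d :
    planar_simplex_circuit R A -> supported_on A F1 -> supported_on A F2 ->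
    @ctorus R[i] w ->
    solutions F1 F2 (dilate w x0) -> solutions F1 F2 (dilate w x1) ->
    solutions F1 F2 (dilate w x2) -> x0 <> x1 -> x1 <> x2 ->
    A = [fset a; b; c; d]%fset -> uniq [:: a; b; c; d] ->
    F1 a * F2 b != F1 b * F2 a ->
    dotz c x0 - dotz d x0 <= dotz c x1 - dotz d x1 ->
    dotz c x1 - dotz d x1 <= dotz c x2 - dotz d x2 ->
  infinite_set (solutions F1 F2).
Proof.
move=> circA A1 A2 wT sol0 sol1 sol2 x01 x12 AE Auniq minor h01 h12.
have cross x y : dotz c x - dotz d x <= dotz c y - dotz d y ->
    expR (dotz c x) * expR (dotz d y) <= expR (dotz c y) * expR (dotz d x).
  by move=> xy; rewrite -!expRD ler_expR; lra.
have [s [t [s0 t0 cE dE]]] := nonneg_combination (expR_gt0 _) (expR_gt0 _)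
  (expR_gt0 _) (expR_gt0 _) (expR_gt0 _) (expR_gt0 _) (cross _ _ h01) (cross _ _ h12).
apply: (infinite_solutions_middle circA A1 A2 sol0 sol1 wT x01 x12 s0 t0).
(* The defect of the linear relation at each coordinate. It vanishes at [c] and [d] by the choice of
   [s] and [t]; at [a] and [b] it solves a 2 x 2 system whose determinant is the nonzero minor times
   nonzero monomials. *)
pose u e := expR (dotz e x1) - (s * expR (dotz e x0) + t * expR (dotz e x2)).
have u0 F : supported_on A F -> leval F (dilate w x0) = 0 ->
    leval F (dilate w x1) = 0 -> leval F (dilate w x2) = 0 ->
    F a * monomial w a * (u a)%:C + F b * monomial w b * (u b)%:C = 0.
  move=> AF; rewrite !(leval_dilate _ _ AF) => e0 e1 e2.
  have : \sum_(e <- A) F e * monomial w e * (u e)%:C = 0.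
    transitivity (\sum_(e <- A) F e * monomial w e * (expR (dotz e x1))%:C
       - (s%:C * (\sum_(e <- A) F e * monomial w e * (expR (dotz e x0))%:C)
       + t%:C * (\sum_(e <- A) F e * monomial w e * (expR (dotz e x2))%:C))).
      rewrite !mulr_sumr -big_split -sumrB; apply: eq_bigr => e _.
      by rewrite rmorphB rmorphD !rmorphM /=; ring.
    by rewrite e0 e1 e2 !mulr0 addr0 subr0.
  rewrite AE (perm_big [:: a; b; c; d]) /=; last first.
    apply: uniq_perm => // e.
    by rewrite !inE -!orbA.
  rewrite !big_cons big_nil addr0.
  have -> : u c = 0 by rewrite /u cE subrr.
  have -> : u d = 0 by rewrite /u dE subrr.
  by rewrite !mulr0 !addr0.
have [_ [F10 F20]] := sol0; have [_ [F11 F21]] := sol1; have [_ [F12 F22]] := sol2.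
have E1 := u0 _ A1 F10 F11 F12; have E2 := u0 _ A2 F20 F21 F22.
have minor0 : F1 a * F2 b - F1 b * F2 a != 0 by rewrite subr_eq0.
have ua : u a = 0.
  apply/(@complexI R)/(mulfI (monomial_neq0 a wT))/(mulfI minor0); rewrite !mulr0.
  transitivity (F2 b * (F1 a * monomial w a * (u a)%:C + F1 b * monomial w b * (u b)%:C)
    - F1 b * (F2 a * monomial w a * (u a)%:C + F2 b * monomial w b * (u b)%:C)); first by ring.
  by rewrite E1 E2 !mulr0 subr0.
have ub : u b = 0.
  apply/(@complexI R)/(mulfI (monomial_neq0 b wT))/(mulfI minor0); rewrite !mulr0.
  transitivity (F1 a * (F2 a * monomial w a * (u a)%:C + F2 b * monomial w b * (u b)%:C)
    - F2 a * (F1 a * monomial w a * (u a)%:C + F1 b * monomial w b * (u b)%:C)); first by ring.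
  by rewrite E1 E2 !mulr0 subr0.
move=> e; rewrite AE !inE -!orbA => /or4P[] /eqP -> //;
  by apply/eqP; rewrite -subr_eq0; apply/eqP.
Qed.

(** Unless all minors vanish, a nonzero one selects two points of [A]; the remaining two define the
    function [h] by which the three solutions are sorted. *)
Lemma infinite_solutions_three A (F1 F2 : laurent R[i]) w x0 x1 x2 :
    planar_simplex_circuit R A -> supported_on A F1 -> supported_on A F2 ->
    @ctorus R[i] w ->
    solutions F1 F2 (dilate w x0) -> solutions F1 F2 (dilate w x1) ->
    solutions F1 F2 (dilate w x2) -> x0 <> x1 -> x1 <> x2 -> x0 <> x2 ->
  infinite_set (solutions F1 F2).
Proof.
move=> circA A1 A2 wT sol0 sol1 sol2 x01 x12 x02.
have [minors|/existsNP[a /existsNP[b /eqP minor]]] :=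
    pselect (forall a b, F1 a * F2 b = F1 b * F2 a).
  exact: infinite_solutions_dependent sol0.
have ab : a != b by apply: contraNneq minor => ->.
have supp (F : laurent R[i]) e : supported_on A F -> e \notin A -> F e = 0.
  by move=> AF eA; apply: fsfun_dflt; apply: contra eA; apply: (fsubsetP AF).
have mem e f : F1 e * F2 f != F1 f * F2 e -> e \in A.
  apply: contra_neqT => eA.
  by rewrite (supp F1 e) // (supp F2 e) // mul0r mulr0.
have aA : a \in A by apply: mem minor.
have bA : b \in A by apply: (mem b a); rewrite eq_sym.
have [A4 _] := circA.
have bA' : b \in (A `\ a)%fset by rewrite !inE eq_sym ab.
have A2' : #|` (A `\ a `\ b)%fset| = 2%N.
  by move: A4; rewrite (cardfsD1 a) aA (cardfsD1 b) bA'; lia.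
have [c [d [cd cdE]]] : exists c d, c != d /\ (A `\ a `\ b = [fset c; d])%fset.
  have /fset0Pn[c cP] : (A `\ a `\ b != fset0)%fset by rewrite -cardfs_gt0 A2'.
  have /cardfs1P[d dE] : #|` (A `\ a `\ b `\ c)%fset| == 1%N.
    by move: A2'; rewrite (cardfsD1 c) cP; lia.
  exists c, d; split; last by rewrite -dE fsetD1K.
  have : d \in (A `\ a `\ b `\ c)%fset by rewrite dE inE.
  by rewrite !inE eq_sym => /andP[].
have AE : A = [fset a; b; c; d]%fset.
  by rewrite -(fsetD1K aA) -(fsetD1K bA') cdE !fsetUA.
have Auniq : uniq [:: a; b; c; d].
  have : c \in (A `\ a `\ b)%fset by rewrite cdE !inE eqxx.
  have : d \in (A `\ a `\ b)%fset by rewrite cdE !inE eqxx orbT.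
  rewrite !inE => /and3P[db da _] /and3P[cb ca _].
  by rewrite /= !inE !negb_or ab cd !(eq_sym a) !(eq_sym b) ca da cb db.
pose h x := dotz c x - dotz d x.
have sorted u v (z : R * R) : solutions F1 F2 (dilate w u) -> solutions F1 F2 (dilate w v) ->
    solutions F1 F2 (dilate w z) -> u <> v -> v <> z -> h u <= h v -> h v <= h z ->
    infinite_set (solutions F1 F2).
  move=> su sv sz uv vz.
  exact: (infinite_solutions_sorted circA A1 A2 wT su sv sz uv vz AE Auniq minor).
have [h01|/ltW h10] := leP (h x0) (h x1); have [h12|/ltW h21] := leP (h x1) (h x2);
  have [h02|/ltW h20] := leP (h x0) (h x2).
- exact: (sorted x0 x1 x2).
- exact: (sorted x0 x1 x2).
- exact: (sorted x0 x2 x1 _ _ _ _ (nesym x12)).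
- exact: (sorted x2 x0 x1 _ _ _ (nesym x02)).
- exact: (sorted x1 x0 x2 _ _ _ (nesym x01)).
- exact: (sorted x1 x2 x0 _ _ _ _ (nesym x02)).
- exact: (sorted x2 x1 x0 _ _ _ (nesym x12) (nesym x01)).
- exact: (sorted x2 x1 x0 _ _ _ (nesym x12) (nesym x01)).
Qed.
End Sector.

Theorem theorem7p1 (R : realType) (A : {fset int * int})
    (F1 F2 : laurent R[i])
    (circuitA : planar_simplex_circuit R A)
    (suppF1 : supported_on A F1) (suppF2 : supported_on A F2)
    (genF : generic_system F1 F2)
    (theta : circle R * circle R) :
  sector theta `&` solutions F1 F2 #<= `I_2.
Proof.
apply: contrapT => /(three_of_card_gt2 (sub_finite_set (@subIsetr _ _ _) genF)).
move=> [z0 [z1 [z2 [[[s0 sol0] [s1 sol1] [s2 sol2]] [z01 z12 z02]]]]].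
have [x1 z1E] := sector_dilate s0 s1; have [x2 z2E] := sector_dilate s0 s2.
(* The first solution serves as base point, so its own logarithmic coordinate is 0. *)
have z0E : z0 = dilate z0 (0, 0) by rewrite /dilate /= expR0 !mulr1; case: (z0).
move: (sol0) z01 z02; rewrite {1}z0E => sol0' z01 z02; subst z1 z2.
have := infinite_solutions_three circuitA suppF1 suppF2 (proj1 sol0) sol0' sol1 sol2.
apply=> // [e|e|e].
- by apply: z01; rewrite -e.
- by apply: z12; rewrite e.
- by apply: z02; rewrite -e.
Qed.
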